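(* Let $\tilde X_n$ be an $n\times p$ random matrix with $p/n\to\gamma\in[0,1)$ as $n\to\infty$. Assume that the rows of $\tilde X_n$ are independent and identically distributed as $\mathcal N(0,\tilde\Sigma_n)$, where the $p\times p$ covariance matrices $\tilde\Sigma_n$ satisfy $$c_m\le \inf_{n\ge1}\lambda_{\min}(\tilde\Sigma_n)\le\sup_{n\ge1}\lambda_{\max}(\tilde\Sigma_n)\le c_M$$ for some universal constants $0<c_m\le c_M<\infty$. Then for any fixed $r\ge0$ there exists a positive universal constant $K_1(r)$ (depending only on $r$, $\gamma$, $c_m$ and $c_M$) such that $$\mathbb E\big[\{\kappa(\tilde X_n)\}^r\big]\le K_1(r)$$ for all $n$.
   Context: The dimension $p=p_n$ may depend on $n$. For $A\in\mathbb R^{n\times p}$, $s_{\max}(A)$ is the largest singular value and $s_{\min}(A)$ is the $\min(n,p)$-th singular value when the singular values are arranged in descending order; the condition number is $\kappa(A)=s_{\max}(A)/s_{\min}(A)$. Under the stated assumptions $\tilde X_n$ has rank $\min(n,p)$ almost surely, so $s_{\min}(\tilde X_n)$ is its smallest nonzero singular value. $\lambda_{\min},\lambda_{\max}$ denote the smallest and largest eigenvalues of a symmetric matrix.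
   Formalization: The bound is proved for all sufficiently large n (threshold depending on the sequence), not for all n: with p_1=1, p_n=2 for n≥2 and identity covariance, the moment is infinite at n=2 for every r≥1. *)

(* Defs.v *)
From HB Require Import structures.
From mathcomp Require Export all_boot all_order all_algebra.
From mathcomp Require Export all_classical all_reals all_analysis.
Export Order.TTheory GRing.Theory Num.Theory.
Export numFieldNormedType.Exports.

Set Implicit Arguments.
Unset Strict Implicit.
Unset Printing Implicit Defensive.

Local Open Scope classical_set_scope.
Local Open Scope ring_scope.

(* Roots of the characteristic polynomial of A, with multiplicity, in
   descending order. The factorization determines the list up to permutation,
   so the sorted list does not depend on the choice made by xget. When the
   characteristic polynomial does not split over R (which cannot happen for a
   symmetric A), the list is empty. *)
Definition eigenvalues_desc (R : realType) (m : nat) (A : 'M[R]_m) : seq R :=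
  sort >=%R
    (xget [::] [set s | char_poly A = \prod_(z <- s) ('X - z%:P)]).

Definition lambda_max (R : realType) (m : nat) (A : 'M[R]_m) : R :=
  head 0 (eigenvalues_desc A).

Definition lambda_min (R : realType) (m : nat) (A : 'M[R]_m) : R :=
  last 0 (eigenvalues_desc A).

(* Singular values are indexed from 0 in descending order, so k = 0 gives the
   largest one. *)
Definition singular_value (R : realType) (n p : nat) (A : 'M[R]_(n, p))
    (k : nat) : R :=
  Num.sqrt (nth 0 (eigenvalues_desc (A^T *m A)) k).

Definition s_max (R : realType) (n p : nat) (A : 'M[R]_(n, p)) : R :=
  singular_value A 0.

Definition s_min (R : realType) (n p : nat) (A : 'M[R]_(n, p)) : R :=
  singular_value A (minn n p).-1.

(* Rank-deficient matrices get condition number +oo, rather than the value 0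
   that division by zero would give. *)
Definition condition_number (R : realType) (n p : nat) (A : 'M[R]_(n, p)) :
    \bar R :=
  if s_min A == 0 then +oo%E else (s_max A / s_min A)%:E.

(* The real normal law of mean m and variance v. The library's normal_prob takes
   the standard deviation, and it is not the point mass when that is 0. *)
Definition normal_law (R : realType) (m v : R) : set R -> \bar R :=
  fun B => if v == 0 then \d_m B else normal_prob m (Num.sqrt v) B.

(* Y ~ N(mu, Sigma): every linear functional a of Y is normal, with mean mu a
   and variance a^T Sigma a. *)
Definition gaussian_vector d (T : measurableType d) (R : realType)
    (P : probability T R) (p : nat) (Y : T -> 'rV[R]_p)
    (mu : 'rV[R]_p) (Sigma : 'M[R]_p) : Prop :=
  forall (a : 'cV[R]_p) (B : set R), measurable B ->
    P [set w | B ((Y w *m a) ord0 ord0)] =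
    normal_law ((mu *m a) ord0 ord0) ((a^T *m Sigma *m a) ord0 ord0) B.

Definition random_matrix d (T : measurableType d) (R : realType)
    (n p : nat) (X : T -> 'M[R]_(n, p)) : Prop :=
  forall i j, measurable_fun [set: T] (fun w => X w i j).

Definition borel_rV (R : realType) (p : nat) : set (set 'rV[R]_p) :=
  <<s [set U | open U] >>.

(* The product rule for subfamilies is the case where some B i is the whole
   space. *)
Definition independent_vectors d (T : measurableType d) (R : realType)
    (P : probability T R) (n p : nat) (Y : 'I_n -> T -> 'rV[R]_p) : Prop :=
  forall B : 'I_n -> set 'rV[R]_p, (forall i, borel_rV (B i)) ->
    P [set w | forall i, B i (Y i w)] =
    (\prod_(i < n) P [set w | B i (Y i w)])%E.

Definition iid_gaussian_rows d (T : measurableType d) (R : realType)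
    (P : probability T R) (n p : nat) (X : T -> 'M[R]_(n, p))
    (Sigma : 'M[R]_p) : Prop :=
  independent_vectors P (fun i w => row i (X w)) /\
  forall i, gaussian_vector P (fun w => row i (X w)) 0 Sigma.

(* Main.v *)
Require Import Defs.
From mathcomp Require Import measurable_realfun.
From mathcomp Require Import spectral complex.
From mathcomp Require Import ring lra zify.

(** Why the moments of the condition number stay bounded.

    Write |x| for the Euclidean norm; the squared norm [sqn] is used
    throughout. The singular values s_max and s_min of X are attained at unit
    vectors, so a large condition number is visible through the images X y of
    single vectors. For a fixed y with 1/4 <= |y|^2 <= 1 the coordinates of X y
    are independent centred normal variables whose variance y^T Sigma y lies
    between c_m / 4 and c_M, and independence gives two bounds whose exponent is
    n: |X y|^2 <= e^2 n has probability at most (C e)^n ([gaussian_small_ball]),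
    because the normal density is bounded, and |X y|^2 >= 16 c_M (L + 1) n has
    probability at most (4 / 2^L)^n
    ([gaussian_upper_tail]). Both are union bounds over the possible magnitudes
    of the n coordinates, in which the sum over all level patterns factorizes
    ([chernoff_levels]); no expectation is computed.

    A net of the unit sphere of mesh 1/m has at most (4 exp(1) m)^p points
    ([card_sphere_net]). If the condition number is at least m, then either a
    point of the net of mesh 1/2 is stretched a lot (so that s_max is large) or a
    point of the net of mesh 1/m is contracted a lot, since s_min <= s_max / m
    ([condition_number_net]). The union bound over the second net costs m^p and
    gains m^-n, so it leaves m^-(n - p), which is still exponentially small in n
    because p / n stays below some g < 1. The price m^p of the net is why the
    exponent of the small ball estimate has to be n itself, and not a fraction of
    it. Taking m = b^a and L = b with a (1 - g) >= 2 balances the two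
    contributions, and both become at most (C / b)^n ([condition_number_tail]).

    Finally, let b run through the powers of two and let N >= r. From one power to
    the next the N-th power of b^a grows by the factor 2^(a N), while the bound on
    the probability shrinks by the factor 2^-n. As soon as n > a N the layers of
    the N-th moment form a convergent geometric series, whose sum involves neither
    n nor p ([integral_poweR_dyadic]). *)

Set Implicit Arguments.
Unset Strict Implicit.
Unset Printing Implicit Defensive.

Local Open Scope classical_set_scope.
Local Open Scope ring_scope.

(** * Two bounds on the normal law *)

Lemma measurable_EFin_normal_pdf (R : realType) (m s : R) (D : set R) :
  measurable_fun D (EFin \o (normal_pdf m s : R -> R)).
Proof.
apply: (@measurable_funTS _ _ (measurableTypeR R)).
by apply/measurable_EFinP; exact: measurable_normal_pdf.
Qed.

Lemma normal_prob_small_ball (R : realType) (s a : R) : 0 < s -> 0 <= a ->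
  (normal_prob 0 s [set x | (`|x| <= a)%R] <= (a / s)%:E)%E.
Proof.
move=> s0 a0; have sN0 : s != 0 by rewrite gt_eqF.
have setE : [set x : R | `|x| <= a] = `[- a, a]%classic.
  by apply/seteqP; split => x /=; rewrite in_itv /= ler_norml.
rewrite /normal_prob setE; set D := (X in integral _ X).
have mD : measurable (D : set (measurableTypeR R)) by exact: measurable_itv.
apply: (@le_trans _ _
    (\int[lebesgue_measure]_(x in D) (normal_peak s)%:E)%E).
  apply: ge0_le_integral => //=.
  - by move=> x _; rewrite lee_fin normal_pdf_ge0.
  - exact: measurable_EFin_normal_pdf.
  - by move=> x _; rewrite lee_fin normal_pdf_ub.
rewrite integral_cst //= /D lebesgue_measure_itv /= lte_fin.
have peak_le : normal_peak s * 2 <= s^-1.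
  rewrite /normal_peak -mulrnAr sqrtrM ?sqr_ge0 // sqrtr_sqr gtr0_norm //.
  rewrite invfM -mulrA ler_piMr ?invr_ge0 ?(ltW s0) //.
  rewrite mulrC ler_pdivrMr; last first.
    by rewrite sqrtr_gt0 mulrn_wgt0 ?pi_gt0.
  rewrite mul1r -[leLHS]ger0_norm // -sqrtr_sqr ler_wsqrtr //.
  by have := pi_ge2 R; rewrite -mulr_natr; lra.
case: ifP => _; last by rewrite mule0 lee_fin divr_ge0 // ltW.
rewrite -EFinB -EFinM lee_fin opprK mulrC [a / s]mulrC -[a + a]mulr2n -mulr_natr.
rewrite -mulrA mulrC [2 * _]mulrC; exact: ler_wpM2r.
Qed.

(** On |x| >= a the density of standard deviation s is dominated by
    2 exp(- a^2 / (4 s^2)) times the density of standard deviation 2 s, whose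
    total mass is 1: the peaks differ by the factor 2, and part of the exponential
    decay is left over. *)
Lemma normal_prob_tail (R : realType) (s a : R) : 0 < s -> 0 <= a ->
  (normal_prob 0 s [set x | (a <= `|x|)%R]
     <= (2 * expR (- (a ^+ 2 / (4 * s ^+ 2))))%:E)%E.
Proof.
move=> s0 a0; have sN0 : s != 0 by rewrite gt_eqF.
have s20 : 0 < 2 * s by rewrite mulr_gt0.
have s2N0 : 2 * s != 0 by rewrite gt_eqF.
set c := 2 * _.
have c0 : 0 <= c by rewrite mulr_ge0 // expR_ge0.
have mA : measurable ([set x | a <= `|x|] : set (measurableTypeR R)).
  rewrite (_ : [set x | _] = ~` [set` `]- a, a[]); first exact: measurableC.
  apply/seteqP; split => x /=; rewrite in_itv /= -ltr_norml ltNge.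
    by move=> ->.
  by move/negP; rewrite negbK.
have peakE : normal_peak s = 2 * normal_peak (2 * s).
  rewrite /normal_peak.
  have -> : (2 * s) ^+ 2 * pi *+ 2 = 2 ^+ 2 * (s ^+ 2 * pi *+ 2) by ring.
  by rewrite sqrtrM ?sqr_ge0 // sqrtr_sqr ger0_norm // invfM mulrA divff ?mul1r.
apply: (@le_trans _ _ (\int[lebesgue_measure]_(x in [set x | (a <= `|x|)%R])
    (c%:E * (normal_pdf 0 (2 * s) x)%:E))%E).
  apply: ge0_le_integral => //=.
  - by move=> x _; rewrite lee_fin normal_pdf_ge0.
  - exact: measurable_EFin_normal_pdf.
  - by apply: measurable_funeM; exact: measurable_EFin_normal_pdf.
  - move=> x /= ax; rewrite -EFinM lee_fin !normal_pdfE // peakE /c; set e := expR _.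
    rewrite -!mulrA ler_pM2l // mulrCA ler_pM2l ?normal_peak_gt0 // /normal_fun /e -expRD.
    rewrite ler_expR subr0.
    have : a ^+ 2 <= x ^+ 2.
      by rewrite -[x ^+ 2]real_normK ?num_real // lerXn2r ?nnegrE.
    have -> : (- x ^+ 2 / (s ^+ 2 *+ 2)) = - x ^+ 2 * 4 / (8 * s ^+ 2).
      by field.
    have -> : - (a ^+ 2 / (4 * s ^+ 2)) + - x ^+ 2 / ((2 * s) ^+ 2 *+ 2)
       = (- 2 * a ^+ 2 - x ^+ 2) / (8 * s ^+ 2) by field.
    rewrite ler_pM2r ?invr_gt0 ?mulr_gt0 ?exprn_gt0 //.
    by have := sqr_ge0 x; lra.
rewrite ge0_integralZl //=; last 2 first.
- exact: measurable_EFin_normal_pdf.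
- by move=> x _; rewrite lee_fin normal_pdf_ge0.
rewrite -[leRHS]mule1 lee_wpmul2l //.
rewrite -(integral_normal_pdf 0 (2 * s)).
apply: ge0_subset_integral => //=.
- exact: measurable_EFin_normal_pdf.
- by move=> x _; rewrite lee_fin normal_pdf_ge0.
Qed.

(** * Squared Euclidean norm *)

Definition sqn (R : realType) (m : nat) (x : 'cV[R]_m) : R :=
  \sum_i x i ord0 ^+ 2.

Lemma sqnE (R : realType) (m : nat) (x : 'cV[R]_m) :
  sqn x = (x^T *m x) ord0 ord0.
Proof. by rewrite mxE; apply: eq_bigr => i _; rewrite mxE expr2. Qed.

Lemma sqn_ge0 (R : realType) (m : nat) (x : 'cV[R]_m) : 0 <= sqn x.
Proof. by apply: sumr_ge0 => i _; exact: sqr_ge0. Qed.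

Lemma sqn_eq0 (R : realType) (m : nat) (x : 'cV[R]_m) : (sqn x == 0) = (x == 0).
Proof.
apply/eqP/eqP => [x0|->]; last first.
  by rewrite /sqn big1 // => i _; rewrite mxE expr0n.
apply/colP => i; rewrite mxE; apply/eqP; rewrite -sqrf_eq0.
by have /psumr_eq0P -> := x0 => // j _; exact: sqr_ge0.
Qed.

Lemma sqnZ (R : realType) (m : nat) (c : R) (x : 'cV[R]_m) :
  sqn (c *: x) = c ^+ 2 * sqn x.
Proof.
by rewrite /sqn mulr_sumr; apply: eq_bigr => i _; rewrite mxE exprMn.
Qed.

(** Convexity of the square. It plays the role of the triangle inequality: only
    constants are lost, and no square root of a norm appears. *)
Lemma sqnD (R : realType) (m : nat) (x y : 'cV[R]_m) :
  sqn (x + y) <= 2 * sqn x + 2 * sqn y.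
Proof.
rewrite /sqn !mulr_sumr -big_split /=; apply: ler_sum => i _; rewrite mxE.
by have := sqr_ge0 (x i ord0 - y i ord0); lra.
Qed.

Lemma sqnN (R : realType) (m : nat) (x : 'cV[R]_m) : sqn (- x) = sqn x.
Proof. by rewrite -scaleN1r sqnZ sqrrN expr1n mul1r. Qed.

(** * Symmetric real matrices *)

Section RealSpectral.
Local Open Scope sesquilinear_scope.

(** The spectral theorem holds over an algebraically closed field, so the matrix
    is diagonalized over R[i]; its eigenvalues are real because a real symmetric
    matrix is Hermitian. *)
Lemma symmetric_spectral (R : realType) (n : nat) (A : 'M[R]_n) : A^T = A ->
  exists (U : 'M[R[i]]_n) (s : 'rV[R]_n), U \is unitarymx /\
    map_mx (real_complex R) A =
      U^t* *m diag_mx (map_mx (real_complex R) s) *m U.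
Proof.
move=> symA; set B := map_mx _ A.
have Bsym : B \is symmetricmx.
  by apply/is_hermitianmxP; rewrite expr0 scale1r map_mx_id // /B map_trmx symA.
have Breal : B \is a mxOver Num.real.
  by apply/mxOverP => i j; rewrite mxE complex_real.
have Bh := realsym_hermsym Bsym Breal.
have /mxOverP dreal := hermitian_spectral_diag_real Bh.
pose s := \row_i complex.Re (spectral_diag B 0 i).
have sE : map_mx (real_complex R) s = spectral_diag B.
  by apply/rowP => i; rewrite !mxE RRe_real.
exists (spectralmx B), s; split; first exact: spectral_unitarymx.
rewrite sE -invmx_unitary ?spectral_unitarymx //.
exact/orthomx_spectralP/hermitian_normalmx.
Qed.

Lemma symmetric_spectral_char_poly (R : realType) (n : nat) (A : 'M[R]_n)
    (U : 'M[R[i]]_n) (d : 'rV[R]_n) :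
  U \is unitarymx ->
  map_mx (real_complex R) A =
    U^t* *m diag_mx (map_mx (real_complex R) d) *m U ->
  char_poly A = \prod_i ('X - (d ord0 i)%:P).
Proof.
move=> Uu eqA.
apply: (@map_inj_poly _ _ (real_complex R)); [exact: complexI|by []|].
rewrite map_char_poly eqA rmorph_prod /=.
under [RHS]eq_bigr do rewrite rmorphB /= map_polyX map_polyC /=.
rewrite -invmx_unitary // /char_poly.
set D := diag_mx _; have Uunit := unitarymx_unit Uu.
have -> : char_poly_mx (invmx U *m D *m U) =
    map_mx polyC (invmx U) *m char_poly_mx D *m map_mx polyC U.
  rewrite /char_poly_mx mulmxBr mulmxBl -!map_mxM /= -scalemx1 -scalemxAr.
  by rewrite mulmx1 -scalemxAl -map_mxM mulVmx // map_mx1.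
rewrite !det_mulmx mulrAC -det_mulmx -map_mxM mulVmx // map_mx1 det1 mul1r.
rewrite -/(char_poly D) char_poly_trig; last exact: diag_mx_is_trig.
by apply: eq_bigr => i _; rewrite !mxE eqxx mulr1n.
Qed.

(** The list picked by [xget] exists because the complex diagonalization splits
    the characteristic polynomial over R. *)
Lemma eigenvalues_descP (R : realType) (n : nat) (A : 'M[R]_n) : A^T = A ->
  char_poly A = \prod_(z <- eigenvalues_desc A) ('X - z%:P).
Proof.
move=> /symmetric_spectral[U [d [Uu /(symmetric_spectral_char_poly Uu) eqA]]].
rewrite /eigenvalues_desc; set S := [set _ | _].
have s0P : S [seq d ord0 i | i : 'I_n] by rewrite /S /= big_image.
have : S (xget [::] S) by apply: (xgetI _ s0P).
rewrite /= => ->; apply: perm_big; by rewrite perm_sym perm_sort.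
Qed.

Lemma size_eigenvalues_desc (R : realType) (n : nat) (A : 'M[R]_n) :
  A^T = A -> size (eigenvalues_desc A) = n.
Proof.
move=> /eigenvalues_descP/(congr1 (fun q : {poly R} => size q)).
by rewrite size_char_poly size_prod_XsubC => -[].
Qed.

Lemma mem_eigenvalues_desc (R : realType) (n : nat) (A : 'M[R]_n) (z : R) :
  A^T = A -> (z \in eigenvalues_desc A) = eigenvalue A z.
Proof.
by move=> /eigenvalues_descP eqA; rewrite eigenvalue_root_char eqA root_prod_XsubC.
Qed.

Lemma unit_eigenvector (R : realType) (n : nat) (A : 'M[R]_n) (z : R) :
  A^T = A -> z \in eigenvalues_desc A ->
  exists x : 'cV[R]_n, sqn x = 1 /\ A *m x = z *: x.
Proof.
move=> symA; rewrite mem_eigenvalues_desc // => /eigenvalueP[v vA v0].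
have sv0 : sqn v^T != 0 by rewrite sqn_eq0 -trmx0 (inj_eq trmx_inj).
have svp : 0 < sqn v^T by rewrite lt_def sv0 sqn_ge0.
exists ((Num.sqrt (sqn v^T))^-1 *: v^T); split.
  by rewrite sqnZ exprVn sqr_sqrtr ?sqn_ge0 // mulVf.
rewrite -scalemxAr -{1}symA -trmx_mul vA linearZ /= scalerA mulrC -scalerA //.
Qed.

Lemma eigenvalues_desc_bounds (R : realType) (n : nat) (A : 'M[R]_n) (z : R) :
  z \in eigenvalues_desc A -> lambda_min A <= z <= lambda_max A.
Proof.
rewrite /lambda_min /lambda_max.
have : sorted >=%R (eigenvalues_desc A).
  by apply: sort_sorted => x y; exact: le_total.
case: (eigenvalues_desc A) => [//|y s] /=.
rewrite (path_sortedE (rev_trans le_trans)).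
move=> /andP[/allP ys sorts] zs; apply/andP; split.
  move: zs sorts ys; elim/last_ind: s => [|s t IH]; rewrite ?last_rcons.
    by rewrite inE => /eqP ->.
  rewrite -rcons_cons mem_rcons inE => /orP[/eqP -> //|zs] sorts ys.
  have := ys t; rewrite mem_rcons inE eqxx => /(_ isT) /= ty.
  move: zs; rewrite inE => /orP[/eqP -> //|zs].
  move: sorts; rewrite (sorted_pairwise (rev_trans le_trans)) pairwise_rcons.
  by move=> /andP[/allP /(_ _ zs)].
by move: zs; rewrite inE => /orP[/eqP -> //|/ys].
Qed.

(** In the unitary coordinates y = U x the quadratic form is the combination of
    the weights |y_i|^2 with the eigenvalues as coefficients, and these weights
    add up to [sqn x]. *)
Lemma rayleigh (R : realType) (n : nat) (A : 'M[R]_n) (x : 'cV[R]_n) :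
  A^T = A ->
  lambda_min A * sqn x <= (x^T *m A *m x) ord0 ord0 <= lambda_max A * sqn x.
Proof.
move=> symA; have [U [d [Uu eqA]]] := symmetric_spectral symA.
pose toC := real_complex R; pose y := U *m map_mx toC x.
pose w i : R := complex.Re (y i ord0) ^+ 2 + complex.Im (y i ord0) ^+ 2.
have w0 i : 0 <= w i by rewrite addr_ge0 ?sqr_ge0.
have wE i : (y i ord0)^* * y i ord0 = toC (w i).
  by rewrite /toC /w add_Re2_Im2 normCK mulrC.
have yt : y^t* = (map_mx toC x)^T *m U^t*.
  rewrite /y trmx_mul map_mxM /= -map_trmx; congr (_ *m _).
  by apply/matrixP => i j; rewrite !mxE; exact: conjc_real.
have quadE (B : 'M[R]_n) (e : 'rV[R]_n) :
    map_mx toC B = U^t* *m diag_mx (map_mx toC e) *m U ->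
    (x^T *m B *m x) ord0 ord0 = \sum_i e ord0 i * w i.
  move=> eqB; apply: (@complexI R); rewrite rmorph_sum /=.
  transitivity ((y^t* *m diag_mx (map_mx toC e) *m y) ord0 ord0).
    rewrite yt /y !mulmxA -!(mulmxA (map_mx toC x)^T) -eqB map_trmx -!map_mxM.
    by rewrite [RHS]mxE mulmxA.
  have diagE (v : 'cV[R[i]]_n) f :
      (v^t* *m diag_mx f *m v) ord0 ord0 =
      \sum_i f ord0 i * ((v i ord0)^* * v i ord0).
    rewrite mul_mx_diag mxE; apply: eq_bigr => i _.
    by rewrite !mxE mulrCA mulrA.
  rewrite diagE; apply: eq_bigr => i _; rewrite wE mxE.
  exact/esym/rmorphM.
have eig i : d ord0 i \in eigenvalues_desc A.
  rewrite mem_eigenvalues_desc // eigenvalue_root_char.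
  rewrite (symmetric_spectral_char_poly Uu eqA) (bigD1 i) //=.
  by rewrite rootM root_XsubC eqxx.
have sx : sqn x = \sum_i w i.
  rewrite sqnE -[x^T]mulmx1 (quadE 1%:M (const_mx 1)).
    by apply: eq_bigr => i _; rewrite mxE mul1r.
  rewrite map_mx1 map_const_mx rmorph1 diag_const_mx mulmx1.
  by rewrite -invmx_unitary // mulVmx // unitarymx_unit.
rewrite (quadE A d eqA) sx !mulr_sumr; apply/andP; split; apply: ler_sum => i _;
  by apply: ler_wpM2r => //; have /andP[] := eigenvalues_desc_bounds (eig i).
Qed.

End RealSpectral.

(** * Union bounds over patterns *)

Lemma union_bound d (T : measurableType d) (R : realType)
    (P : probability T R) (I : finType) (F : I -> set T) (q : I -> R)
    (G : pred I) (E : set T) :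
  measurable E -> (forall i, G i -> measurable (F i)) ->
  (forall w, E w -> exists2 i, G i & F i w) ->
  (forall i, G i -> P (F i) <= (q i)%:E)%E ->
  (P E <= (\sum_(i | G i) q i)%:E)%E.
Proof.
move=> mE mF cover le_q.
apply: (@le_trans _ _ (P (\big[setU/set0]_(i <- index_enum I | G i) F i))).
  apply: le_measure; rewrite ?inE //; first exact: bigsetU_measurable.
  move=> w /cover[i Gi Fiw]; rewrite -bigcup_seq_cond; exists i => //=.
  by rewrite mem_index_enum.
rewrite -sumEFin; elim: (index_enum I) => [|i s IH].
  by rewrite !big_nil measure0.
rewrite !big_cons; case: ifPn => Gi //.
have le2 := @measureU2 _ _ _ P (F i) (\big[setU/set0]_(j <- s | G j) F j).
apply: (le_trans (le2 _ _)); [exact: mF|exact: bigsetU_measurable|].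
exact: leeD (le_q _ Gi) IH.
Qed.

(** Multiplying the term of a pattern k by the product of the c (k i), which is
    at least 1 on G, only increases the sum; the sum over all patterns then
    factorizes. This is the exponential Markov inequality for a finite family of
    levels, with c in the role of the exponential. *)
Lemma sum_prod_le (R : realType) (I J : finType) (G : pred {ffun I -> J})
    (q c : J -> R) :
  (forall j, 0 <= q j) -> (forall j, 0 <= c j) ->
  (forall k : {ffun I -> J}, G k -> 1 <= \prod_i c (k i)) ->
  \sum_(k : {ffun I -> J} | G k) \prod_i q (k i)
    <= (\sum_j c j * q j) ^+ #|I|.
Proof.
move=> q0 c0 Gc; rewrite -prodr_const.
rewrite (bigA_distr_bigA (fun _ j => c j * q j)) /= big_mkcond /=.
apply: ler_sum => k _; rewrite big_split /=.
have p0 : 0 <= \prod_i q (k i) by apply: prodr_ge0.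
case: ifPn => [/Gc c1|_]; last by rewrite mulr_ge0 // prodr_ge0.
by rewrite ler_peMl.
Qed.

Lemma weighted_count (R : realType) (I J : finType) (G : pred {ffun I -> J})
    (c : J -> R) :
  (forall j, 0 <= c j) ->
  (forall k : {ffun I -> J}, G k -> 1 <= \prod_i c (k i)) ->
  #|G|%:R <= (\sum_j c j) ^+ #|I|.
Proof.
move=> c0 Gc.
have := sum_prod_le (fun _ => ler01) c0 Gc.
under [X in X <= _]eq_bigr do rewrite big1 //.
rewrite sumr_const; under eq_bigr do rewrite mulr1.
by [].
Qed.

(** The event E is covered by the patterns of levels k : 'I_n -> J whose total
    weight is at least 1. The sets B j may overlap, which allows closed
    half-lines and closed intervals as levels. *)
Lemma chernoff_levels d (T : measurableType d) (R : realType)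
    (P : probability T R) (n : nat) (J : finType) (V : 'I_n -> T -> R)
    (B : J -> set R) (q c : J -> R) (E : set T) :
  measurable E ->
  (forall k : 'I_n -> J, measurable [set w | forall i, B (k i) (V i w)]) ->
  (forall k : 'I_n -> J,
     P [set w | forall i, B (k i) (V i w)] <= (\prod_i q (k i))%:E)%E ->
  (forall j, 0 <= q j) -> (forall j, 0 <= c j) ->
  (forall w, E w -> exists k : 'I_n -> J,
     (forall i, B (k i) (V i w)) /\ 1 <= \prod_i c (k i)) ->
  (P E <= ((\sum_j c j * q j) ^+ n)%:E)%E.
Proof.
move=> mE mB Pq q0 c0 cover.
pose G := [pred k : {ffun 'I_n -> J} | 1 <= \prod_i c (k i)].
apply: (@le_trans _ _ (\sum_(k | G k) \prod_i q (k i))%:E).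
  apply: (union_bound (F := fun k : {ffun 'I_n -> J} =>
            [set w | forall i, B (k i) (V i w)])) => // w /cover[k [Bk ck]].
  exists (finfun k).
    by rewrite /G /=; under eq_bigr do rewrite ffunE.
  by move=> i /=; rewrite ffunE.
rewrite lee_fin.
have := sum_prod_le q0 c0 (fun k (Gk : G k) => Gk).
by rewrite card_ord.
Qed.

(** * Images of a fixed vector under a Gaussian matrix *)

(** The levels used below are closed sets of values, whose preimages under a
    linear functional are closed by continuity. *)
Lemma borel_rV_closed_functional (R : realType) (p : nat) (a : 'cV[R]_p)
    (B : set R) :
  closed B -> borel_rV [set v : 'rV[R]_p | B ((v *m a) ord0 ord0)].
Proof.
move=> cB; have cont : continuous (fun v : 'rV[R]_p => (v *m a) ord0 ord0).
  have -> : (fun v : 'rV[R]_p => (v *m a) ord0 ord0) =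
      (fun v => \sum_j v ord0 j * a j ord0).
    by apply/funext => v; rewrite mxE.
  apply: continuous_big; first exact: add_continuous.
  move=> j _ v; apply: cvgM; [exact: (nbhs_filter v)| |];
    last exact: (@cst_continuous _ _ (a j ord0) v).
  exact: coord_continuous.
set F := [set v | _]; rewrite -(setCK F) -setTD; apply: sigma_algebraCD.
apply: sub_sigma_algebra => /=; rewrite openC.
by apply: preimage_closed => // v _; exact: cont.
Qed.

Lemma measurable_mulmx_coord d (T : measurableType d) (R : realType)
    (n p : nat) (X : T -> 'M[R]_(n, p)) (y : 'cV[R]_p) (i : 'I_n) :
  random_matrix X -> measurable_fun [set: T] (fun w => (X w *m y) i ord0).
Proof.
move=> mX; under eq_fun do rewrite mxE.
apply: measurable_sum => j; exact: measurable_funM.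
Qed.

Lemma measurable_sqn_mulmx d (T : measurableType d) (R : realType)
    (n p : nat) (X : T -> 'M[R]_(n, p)) (y : 'cV[R]_p) :
  random_matrix X -> measurable_fun [set: T] (fun w => sqn (X w *m y)).
Proof.
move=> mX; apply: measurable_sum => i; apply: measurable_funX.
exact: measurable_mulmx_coord.
Qed.

(** The coordinates of X y are the same linear functional applied to the rows of
    X. They inherit independence from the rows, and each one is normal with
    variance y^T S y by the definition of a Gaussian vector. *)
Lemma iid_gaussian_rows_levels d (T : measurableType d) (R : realType)
    (P : probability T R) (n p : nat) (X : T -> 'M[R]_(n, p)) (S : 'M[R]_p)
    (y : 'cV[R]_p) (B : 'I_n -> set R) (q : 'I_n -> R) :
  random_matrix X -> iid_gaussian_rows P X S ->
  0 < (y^T *m S *m y) ord0 ord0 ->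
  (forall i, closed (B i)) ->
  (forall i, normal_prob 0 (Num.sqrt ((y^T *m S *m y) ord0 ord0)) (B i)
     <= (q i)%:E)%E ->
  measurable [set w | forall i, B i ((X w *m y) i ord0)] /\
  (P [set w | forall i, B i ((X w *m y) i ord0)] <= (\prod_i q i)%:E)%E.
Proof.
move=> mX [indep gauss] s0 cB Bq.
have rowE i w : (X w *m y) i ord0 = (row i (X w) *m y) ord0 ord0.
  by rewrite -row_mul [RHS]mxE.
split.
  rewrite (_ : [set w | _] =
      \bigcap_(i in [set: 'I_n]) (fun w => (X w *m y) i ord0) @^-1` B i).
    apply: fin_bigcap_measurable => // i _; rewrite -[X in measurable X]setTI.
    apply: measurable_mulmx_coord => //; exact: closed_measurable.
  apply/seteqP; split => w /=; first by move=> H i _; exact: H.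
  by move=> H i; exact: (H i I).
pose F i := [set v : 'rV[R]_p | B i ((v *m y) ord0 ord0)].
rewrite (_ : [set w | _] = [set w | forall i, F i (row i (X w))]); last first.
  by apply/seteqP; split => w /= H i; have := H i; rewrite rowE.
rewrite indep; last by move=> i; exact: borel_rV_closed_functional.
rewrite -prodEFin.
pose le0 (a b : \bar R) := (0 <= a <= b)%E.
suff /andP[] : le0 (\prod_(i < n) P [set w | F i (row i (X w))])%E (\prod_(i < n) (q i)%:E)%E by [].
apply: (big_ind2 le0); first by rewrite /le0 lexx lee_fin ler01.
  move=> a1 b1 a2 b2 /andP[a10 le1] /andP[a20 le2].
  by rewrite /le0 mule_ge0 // lee_pmul.
move=> i _; rewrite /le0 measure_ge0 /= gauss; last exact: closed_measurable.
have -> : ((0 : 'rV[R]_p) *m y) ord0 ord0 = 0 by rewrite mul0mx mxE.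
by rewrite /normal_law gt_eqF // Bq.
Qed.

Lemma sum_half_pow (R : realType) (m : nat) :
  \sum_(k < m) (2 ^+ k)^-1 <= 2 :> R.
Proof.
suff : \sum_(k < m) (2 ^+ k)^-1 = 2 - 2 * (2 ^+ m)^-1 :> R.
  move=> ->; rewrite lerBlDr lerDl mulr_ge0 // invr_ge0 exprn_ge0 //.
elim: m => [|m IH]; first by rewrite big_ord0 expr0 invr1 mulr1 subrr.
rewrite big_ord_recr /= IH exprS.
have : (2 ^+ m : R) != 0 by rewrite expf_neq0.
by move=> H; field.
Qed.

Lemma sum_succ_half_pow (R : realType) (m : nat) :
  \sum_(k < m) k.+1%:R * (2 ^+ k)^-1 <= 4 :> R.
Proof.
suff : \sum_(k < m) k.+1%:R * (2 ^+ k)^-1 = 4 - (2 * m%:R + 4) * (2 ^+ m)^-1 :> R.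
  move=> ->; rewrite lerBlDr lerDl; apply: mulr_ge0.
    by apply: addr_ge0 => //; exact: mulr_ge0.
  by rewrite invr_ge0 exprn_ge0.
elim: m => [|m IH]; first by rewrite big_ord0 expr0 invr1 mulr0 add0r mulr1 subrr.
rewrite big_ord_recr /= IH exprS -[m.+1]addn1 natrD.
have : (2 ^+ m : R) != 0 by rewrite expf_neq0.
by move=> H; field.
Qed.

Lemma closed_norm_le (R : realType) (a : R) : closed [set x : R | `|x| <= a].
Proof.
rewrite (_ : [set x | _] = (@Num.norm _ R) @^-1` [set x | x <= a]) //.
by apply: preimage_closed; [move=> x _; exact: norm_continuous|exact: closed_le].
Qed.

Lemma closed_norm_ge (R : realType) (a : R) : closed [set x : R | a <= `|x|].
Proof.
rewrite (_ : [set x | _] = (@Num.norm _ R) @^-1` [set x | x >= a]) //.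
by apply: preimage_closed; [move=> x _; exact: norm_continuous|exact: closed_ge].
Qed.

Section concentration.
Context d (T : measurableType d) (R : realType) (P : probability T R).
Context (n p : nat) (X : T -> 'M[R]_(n, p)) (S : 'M[R]_p) (y : 'cV[R]_p).
Hypotheses (mX : random_matrix X) (gX : iid_gaussian_rows P X S).
Let s2 : R := (y^T *m S *m y) ord0 ord0.

(** Coordinate i is put on level k, the largest integer with k e <= |(X y)_i|.
    Since k <= k^2, the levels add up to at most n when |X y|^2 <= e^2 n, and the
    weights 2 / 2^k then multiply to at least 1. Level k has probability at most
    (k + 1) e / s, so the weighted sum over the levels is at most 8 e / s. *)
Lemma gaussian_small_ball (s e : R) : 0 < s -> s ^+ 2 <= s2 -> 0 < e ->
  (P [set w | (sqn (X w *m y) <= e ^+ 2 * n%:R)%R]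
     <= ((8 * e / s) ^+ n)%:E)%E.
Proof.
move=> s0 ss2 e0.
have s20 : 0 < s2 by apply: lt_le_trans ss2; exact: exprn_gt0.
have ssq : s <= Num.sqrt s2.
  by rewrite -[s]gtr0_norm // -sqrtr_sqr ler_wsqrtr.
(* The levels stop at n: since each k is at most k^2, none can exceed n. *)
pose B (k : 'I_n.+1) := [set x : R | `|x| <= k.+1%:R * e].
pose q (k : 'I_n.+1) := k.+1%:R * e / s.
pose c (k : 'I_n.+1) : R := 2 / 2 ^+ k.
have q0 k : 0 <= q k by rewrite /q !mulr_ge0 // ?invr_ge0 ltW.
have c0 k : 0 <= c k by rewrite /c divr_ge0 // exprn_ge0.
have levels (k : 'I_n -> 'I_n.+1) := iid_gaussian_rows_levels
  (B := fun i => B (k i)) (q := fun i => q (k i)) mX gX s20.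
have cB (k : 'I_n.+1) : closed (B k) by exact: closed_norm_le.
have Bq (k : 'I_n.+1) : (normal_prob 0 (Num.sqrt s2) (B k) <= (q k)%:E)%E.
  have ke : 0 <= k.+1%:R * e by rewrite mulr_ge0 // ltW.
  apply: (le_trans (normal_prob_small_ball _ ke)); first by rewrite sqrtr_gt0.
  rewrite lee_fin /q ler_wpM2l // lef_pV2 // posrE ?sqrtr_gt0 //.
apply: (@le_trans _ _ ((\sum_k c k * q k) ^+ n)%:E); last first.
  rewrite lee_fin; apply: lerXn2r; rewrite ?nnegrE.
  - by apply: sumr_ge0 => k _; rewrite mulr_ge0.
  - by rewrite !mulr_ge0 // ?invr_ge0 ltW.
  have -> : \sum_k c k * q k =
      (2 * e / s) * \sum_(k < n.+1) k.+1%:R * (2 ^+ k)^-1.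
    by rewrite mulr_sumr; apply: eq_bigr => k _; rewrite /c /q; ring.
  have -> : 8 * e / s = (2 * e / s) * 4 by ring.
  apply: ler_wpM2l; last exact: sum_succ_half_pow.
  by rewrite !mulr_ge0 // ?invr_ge0 ltW.
apply: (chernoff_levels (V := fun i w => (X w *m y) i ord0) (B := B)) => //.
- rewrite -[X in measurable X]setTI.
  by apply: measurable_fun_le => //; exact: measurable_sqn_mulmx.
- by move=> k; have [] := levels k (fun i => cB (k i)) (fun i => Bq (k i)).
- by move=> k; have [] := levels k (fun i => cB (k i)) (fun i => Bq (k i)).
move=> w /= sw.
pose t i := Num.truncn (`|(X w *m y) i ord0| / e).
have tP i := truncn_itv (divr_ge0 (normr_ge0 ((X w *m y) i ord0)) (ltW e0)).
have t2 : (\sum_i t i ^ 2 <= n)%N.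
  rewrite -(ler_nat R) natr_sum -(ler_pM2l (exprn_gt0 2 e0)).
  apply: le_trans sw; rewrite mulr_sumr /sqn; apply: ler_sum => i _.
  rewrite natrX -exprMn -[leRHS]real_normK ?num_real //.
  rewrite lerXn2r ?nnegrE ?mulr_ge0 ?(ltW e0) //.
  by have /andP[+ _] := tP i; rewrite ler_pdivlMr // mulrC.
have tt i : (t i <= t i ^ 2)%N by case: (t i) => // m; rewrite expnS leq_pmulr ?expn_gt0.
have tn i : (t i <= n)%N.
  apply: leq_trans t2; rewrite (bigD1 i) //=; apply: leq_trans (tt i) _.
  exact: leq_addr.
exists (fun i => inord (t i)); split=> [i|].
  rewrite /B /= inordK ?ltnS //.
  by have /andP[_ /ltW] := tP i; rewrite ler_pdivrMr.
under eq_bigr do rewrite /c inordK ?ltnS //.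
rewrite big_split /= prodr_const card_ord prodfV -expr_sum.
rewrite ler_pdivlMr ?exprn_gt0 // mul1r ler_weXn2l ?ler1n //.
by apply: leq_trans t2; exact: leq_sum.
Qed.

(** With u^2 = 8 cM the level k, defined by |(X y)_i| >= k u, has probability at
    most 2 / 4^(k^2). The weights 2^(k^2) / 2^L still give a convergent sum, and
    they multiply to at least 1 as soon as the k^2 add up to at least n L. A large
    |X y|^2 forces this when k is the largest possible level of each coordinate,
    because then (X y)_i^2 <= (k + 1)^2 u^2 <= (2 k^2 + 2) u^2. *)
Lemma gaussian_upper_tail (cM : R) (L : nat) : 0 < s2 -> s2 <= cM ->
  (P [set w | (16 * cM * L.+1%:R * n%:R <= sqn (X w *m y))%R]
     <= ((4 / 2 ^+ L) ^+ n)%:E)%E.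
Proof.
move=> s20 s2M.
have cM0 : 0 < cM by apply: lt_le_trans s2M.
pose u := Num.sqrt (8 * cM).
have u0 : 0 < u by rewrite sqrtr_gt0 mulr_gt0.
have u2 : u ^+ 2 = 8 * cM by rewrite sqr_sqrtr // mulr_ge0 // ltW.
(* The levels are capped at n L: one coordinate on the top level suffices. *)
pose K := (n * L)%N.
pose B (k : 'I_K.+1) := [set x : R | k%:R * u <= `|x|].
pose q (k : 'I_K.+1) : R := 2 / 4 ^+ (k ^ 2)%N.
pose c (k : 'I_K.+1) : R := 2 ^+ (k ^ 2)%N / 2 ^+ L.
have q0 k : 0 <= q k by rewrite /q divr_ge0 // exprn_ge0.
have c0 k : 0 <= c k by rewrite /c divr_ge0 // exprn_ge0.
have levels (k : 'I_n -> 'I_K.+1) := iid_gaussian_rows_levels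
  (B := fun i => B (k i)) (q := fun i => q (k i)) mX gX s20.
have cB (k : 'I_K.+1) : closed (B k) by exact: closed_norm_ge.
have Bq (k : 'I_K.+1) : (normal_prob 0 (Num.sqrt s2) (B k) <= (q k)%:E)%E.
  have ku : 0 <= k%:R * u by rewrite mulr_ge0 // ltW.
  apply: (le_trans (normal_prob_tail _ ku)); first by rewrite sqrtr_gt0.
  rewrite lee_fin /q ler_pM2l // expRN lef_pV2 ?posrE ?expR_gt0 ?exprn_gt0 //.
  rewrite sqr_sqrtr ?(ltW s20) // exprMn u2.
  have e2 : 4 <= expR 2 :> R.
    have -> : 2 = 2%:R * 1 :> R by rewrite mulr1.
    have -> : 4 = 2 ^+ 2 :> R by ring.
    rewrite expRM_natl lerXn2r ?nnegrE ?expR_ge0 //.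
    by have := expR_ge1Dx (1 : R); rewrite -[1 + 1]/(2%:R).
  apply: (@le_trans _ _ (expR 2 ^+ (k ^ 2)%N)).
    by rewrite lerXn2r ?nnegrE ?expR_ge0.
  rewrite -expRM_natl ler_expR natrX ler_pdivlMr ?mulr_gt0 //.
  have -> : k%:R ^+ 2 * 2 * (4 * s2) = k%:R ^+ 2 * (8 * s2) by ring.
  by rewrite ler_wpM2l ?sqr_ge0 // ler_pM2l.
apply: (@le_trans _ _ ((\sum_k c k * q k) ^+ n)%:E); last first.
  rewrite lee_fin; apply: lerXn2r; rewrite ?nnegrE.
  - by apply: sumr_ge0 => k _; rewrite mulr_ge0.
  - by rewrite divr_ge0 // exprn_ge0.
  have -> : \sum_k c k * q k =
      (2 / 2 ^+ L) * \sum_(k < K.+1) (2 ^+ (k ^ 2)%N)^-1.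
    rewrite mulr_sumr; apply: eq_bigr => k _; rewrite /c /q.
    have -> : 4 = 2 * 2 :> R by ring.
    have H : (2 ^+ (k ^ 2)%N : R) != 0 by rewrite expf_neq0.
    have H' : (2 ^+ L : R) != 0 by rewrite expf_neq0.
    by rewrite exprMn; field; rewrite H H'.
  have -> : 4 / 2 ^+ L = (2 / 2 ^+ L) * 2 :> R by ring.
  apply: ler_wpM2l; first by rewrite divr_ge0 // exprn_ge0.
  apply: le_trans (sum_half_pow R K.+1); apply: ler_sum => k _.
  rewrite lef_pV2 ?posrE ?exprn_gt0 // ler_weXn2l ?ler1n //.
  by case: (k : nat) => // m; rewrite expnS leq_pmulr ?expn_gt0.
apply: (chernoff_levels (V := fun i w => (X w *m y) i ord0) (B := B)) => //.
- rewrite -[X in measurable X]setTI.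
  by apply: measurable_fun_le => //; exact: measurable_sqn_mulmx.
- by move=> k; have [] := levels k (fun i => cB (k i)) (fun i => Bq (k i)).
- by move=> k; have [] := levels k (fun i => cB (k i)) (fun i => Bq (k i)).
move=> w /= sw.
pose t i := Num.truncn (`|(X w *m y) i ord0| / u).
have tP i := truncn_itv (divr_ge0 (normr_ge0 ((X w *m y) i ord0)) (ltW u0)).
pose k i := minn (t i) K.
have kK i : (k i < K.+1)%N by rewrite ltnS geq_minr.
exists (fun i => inord (k i)); split=> [i|].
  rewrite /B /= inordK //.
  have /andP[+ _] := tP i; rewrite ler_pdivlMr //; apply: le_trans.
  by rewrite ler_pM2r // ler_nat geq_minl.
under eq_bigr do rewrite /c inordK //.
rewrite big_split /= prodr_const card_ord -expr_sum exprVn -exprM.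
rewrite ler_pdivlMr ?exprn_gt0 // mul1r ler_weXn2l ?ler1n //.
rewrite mulnC -/K.
have [[i Ki]|tK] := pselect (exists i, (K <= t i)%N).
  rewrite (bigD1 i) //= /k (minn_idPr Ki).
  apply: leq_trans (leq_addr _ _).
  by case: (K) => // m; rewrite expnS leq_pmulr ?expn_gt0.
have kt i : k i = t i.
  by apply/minn_idPl; rewrite leqNgt; apply/negP => /ltnW Ki; apply: tK; exists i.
under eq_bigr do rewrite kt.
rewrite -(ler_nat R) /K natrM natr_sum.
have : sqn (X w *m y) <= 8 * cM * (2 * \sum_i (t i ^ 2)%:R + 2 * n%:R).
  have -> : n%:R = \sum_(i < n) 1 :> R by rewrite sumr_const card_ord.
  rewrite !mulr_sumr -big_split /= mulr_sumr; apply: ler_sum => i _.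
  rewrite -[leLHS]real_normK ?num_real //.
  have /andP[_ /ltW] := tP i; rewrite ler_pdivrMr // => le_t.
  apply: (@le_trans _ _ (((t i).+1%:R * u) ^+ 2)).
    by rewrite lerXn2r ?nnegrE ?mulr_ge0 ?(ltW u0).
  rewrite exprMn u2 mulrC ler_pM2l ?mulr_gt0 // -[(t i).+1]addn1 natrD natrX.
  by have := sqr_ge0 ((t i)%:R - 1 : R); lra.
move=> /(le_trans sw).
have -> : 16 * cM * L.+1%:R * n%:R = 8 * cM * (2 * (L.+1%:R * n%:R)) by ring.
rewrite ler_pM2l ?mulr_gt0 // -[L.+1]addn1 natrD mulrDl mul1r.
by rewrite mulrC; lra.
Qed.
End concentration.

(** * A net of the unit sphere *)

(** Vectors with coordinates in the lattice of step 1 / (m sqrt p), stored as sign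
    and magnitude: rounding toward 0 moves a vector by at most 1/m. *)
Definition grid_point (R : realType) (p m : nat)
    (k : {ffun 'I_p -> bool * 'I_(m * p).+1}) : 'cV[R]_p :=
  \col_i ((-1) ^+ (k i).1 * ((k i).2%:R / (m%:R * Num.sqrt p%:R))).

(** The bound on the sum of the magnitudes is the l1 bound that a unit vector
    satisfies after rescaling; it is what lets the net be counted by weights. The
    bounds on the norm keep the variance of X y between two constants. *)
Definition sphere_net (R : realType) (p m : nat) :
    pred {ffun 'I_p -> bool * 'I_(m * p).+1} :=
  [pred k : {ffun 'I_p -> bool * 'I_(m * p).+1} | (\sum_i (k i).2 <= m * p)%N &&
            (4^-1 <= sqn (grid_point R k) <= 1)].

(** Weight a magnitude j by z^(m - j) with z = 1 + 1/m. The weights of a point of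
    the net multiply to at least 1, and their sum over all signs and magnitudes is
    at most 2 z^m (m + 1) <= 4 exp(1) m by the geometric series. *)
Lemma card_sphere_net (R : realType) (p m : nat) : (0 < m)%N ->
  #|sphere_net R (p := p) (m := m)|%:R <= (4 * expR 1 * m%:R) ^+ p :> R.
Proof.
move=> m0; have mR : 0 < m%:R :> R by rewrite ltr0n.
have m1 : 1 <= m%:R :> R by rewrite ler1n.
pose z : R := 1 + m%:R^-1.
have z0 : 0 < z by rewrite addr_gt0 // invr_gt0.
have z1 : 1 <= z by rewrite lerDl invr_ge0 ltW.
have zm : z ^+ m <= expR 1.
  rewrite -[X in expR X](divff (lt0r_neq0 mR)) expRM_natl.
  by rewrite lerXn2r ?nnegrE ?expR_ge0 ?(ltW z0) // expR_ge1Dx.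
pose c (j : bool * 'I_(m * p).+1) := z ^+ m / z ^+ j.2.
have c0 j : 0 <= c j by rewrite divr_ge0 // exprn_ge0 // ltW.
have Gc (k : {ffun 'I_p -> bool * 'I_(m * p).+1}) :
    sphere_net R k -> 1 <= \prod_i c (k i).
  move=> /andP[km _]; rewrite big_split /= prodr_const card_ord prodfV.
  rewrite -expr_sum -exprM ler_pdivlMr ?exprn_gt0 // mul1r.
  exact: ler_weXn2l.
apply: le_trans (weighted_count c0 Gc) _; rewrite card_ord.
rewrite lerXn2r ?nnegrE ?sumr_ge0 ?mulr_ge0 ?expR_ge0 //.
have geo K : \sum_(j < K) (z ^+ j)^-1 <= m%:R + 1.
  suff : \sum_(j < K) (z ^+ j)^-1 = (m%:R + 1) - m%:R * z * (z ^+ K)^-1.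
    move=> ->; rewrite lerBlDr lerDl mulr_ge0 // ?invr_ge0 ?exprn_ge0 ?mulr_ge0 //;
    exact: ltW.
  have mz : m%:R * z = m%:R + 1 by rewrite mulrDr mulr1 divff // lt0r_neq0.
  elim: K => [|K IH]; first by rewrite big_ord0 expr0 invr1 mulr1 mz subrr.
  rewrite big_ord_recr /= IH exprS mz.
  have zK : z ^+ K != 0 by rewrite expf_neq0 // lt0r_neq0.
  have -> : (m%:R + 1) / (z * z ^+ K) = m%:R / z ^+ K.
    rewrite -mz; field; by rewrite zK lt0r_neq0.
  by field.
have -> : \sum_j c j = z ^+ m * (2 * \sum_(j < (m * p).+1) (z ^+ j)^-1).
  rewrite -(pair_bigA _ (fun _ j => z ^+ m / z ^+ (nat_of_ord j))) /=.
  rewrite sumr_const card_bool -mulr_sumr -mulrnAr; congr (_ * _).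
  by rewrite mulr_natl.
have -> : 4 * expR 1 * m%:R = expR 1 * (2 * (2 * m%:R)) :> R by ring.
apply: ler_pM => //; first by rewrite exprn_ge0 // ltW.
  by rewrite mulr_ge0 // sumr_ge0 // => j _; rewrite invr_ge0 exprn_ge0 // ltW.
by rewrite ler_pM2l //; apply: le_trans (geo _) _; lra.
Qed.

(** The magnitudes t_i satisfy t_i <= m sqrt p |x_i| <= m (p x_i^2 + 1) / 2, and
    the right-hand sides add up to m p when |x| = 1. *)
Lemma sphere_net_approx (R : realType) (p m : nat) (x : 'cV[R]_p) :
  (1 < m)%N -> sqn x = 1 ->
  exists2 k, sphere_net R (p := p) (m := m) k
           & sqn (x - grid_point R k) <= (m%:R ^+ 2)^-1.
Proof.
move=> m1 x1; have m0 : 0 < m%:R :> R by rewrite ltr0n; lia.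
have p0 : (0 < p)%N.
  case: p x x1 => // x; rewrite /sqn big_ord0 => /esym/eqP.
  by rewrite oner_eq0.
have pR : 0 < p%:R :> R by rewrite ltr0n.
pose h := (m%:R * Num.sqrt p%:R : R)^-1.
have sp0 : 0 < Num.sqrt p%:R :> R by rewrite sqrtr_gt0.
have h0 : 0 < h by rewrite invr_gt0 mulr_gt0.
pose t i := Num.truncn (`|x i ord0| / h).
have tP i := truncn_itv (divr_ge0 (normr_ge0 (x i ord0)) (ltW h0)).
have tle i : (t i)%:R * h <= `|x i ord0|.
  by have /andP[+ _] := tP i; rewrite ler_pdivlMr.
have sumt : (\sum_i t i <= m * p)%N.
  rewrite -(ler_nat R) natr_sum natrM.
  apply: (@le_trans _ _ (\sum_i m%:R / 2 * (p%:R * x i ord0 ^+ 2 + 1))).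
    apply: ler_sum => i _; have /andP[+ _] := tP i.
    rewrite -/(t i) => /le_trans; apply; rewrite invrK -[x i ord0 ^+ 2]real_normK ?num_real //.
    rewrite -[X in _ * (X * _ + 1)](sqr_sqrtr (ltW pR)).
    have := sqr_ge0 (Num.sqrt p%:R * `|x i ord0| - 1).
    rewrite -(ler_pM2l m0) => H.
    by rewrite mulr0 in H; lra.
  rewrite -mulr_sumr big_split /= -mulr_sumr sumr_const card_ord.
  by move: x1; rewrite /sqn => ->; lra.
have tlt i : (t i < (m * p).+1)%N.
  by rewrite ltnS; apply: leq_trans sumt; rewrite (bigD1 i) //= leq_addr.
pose k := [ffun i => (x i ord0 < 0, inord (t i)) : bool * 'I_(m * p).+1].
have gE i : grid_point R k i ord0 = (-1) ^+ (x i ord0 < 0)%R * ((t i)%:R * h).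
  by rewrite mxE ffunE /= inordK.
have d2 : sqn (x - grid_point R k) <= (m%:R ^+ 2)^-1.
  have -> : (m%:R ^+ 2)^-1 = \sum_(i < p) h ^+ 2 :> R.
    rewrite sumr_const card_ord /h exprVn exprMn sqr_sqrtr ?(ltW pR) //.
    rewrite -mulr_natl; field; by rewrite !lt0r_neq0.
  apply: ler_sum => i _; rewrite 2!mxE gE {1}[x i ord0]numEsign -mulrBr.
  rewrite exprMn sqrr_sign mul1r lerXn2r ?nnegrE ?(ltW h0) ?subr_ge0 //.
  rewrite lerBlDl; have /andP[_ /ltW] := tP i; rewrite ler_pdivrMr //.
  by rewrite -[_.+1%:R]natr1 mulrDl mul1r.
have g1 : sqn (grid_point R k) <= 1.
  rewrite -x1; apply: ler_sum => i _; rewrite gE exprMn sqrr_sign mul1r.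
  rewrite -[leRHS]real_normK ?num_real // lerXn2r ?nnegrE //.
  by rewrite mulr_ge0 // ltW.
exists k => //; apply/andP; split; last (apply/andP; split=> //).
  by under eq_bigr do rewrite ffunE /= inordK //.
have := sqnD (x - grid_point R k) (grid_point R k).
rewrite subrK x1.
have : (m%:R ^+ 2)^-1 <= 4^-1 :> R.
  rewrite lef_pV2 ?posrE ?exprn_gt0 // -natrX (ler_nat R 4).
  by case: m m1 {m0 h h0 t tP tle sumt tlt k gE d2 g1} => [|[|m]] //; rewrite expnS; lia.
by move: d2; lra.
Qed.

(** * Condition number and nets *)

Lemma sqn_gram (R : realType) (n p : nat) (A : 'M[R]_(n, p)) (x : 'cV[R]_p) :
  sqn (A *m x) = (x^T *m (A^T *m A) *m x) ord0 ord0.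
Proof. by rewrite sqnE trmx_mul !mulmxA. Qed.

Lemma gram_sym (R : realType) (n p : nat) (A : 'M[R]_(n, p)) :
  (A^T *m A)^T = A^T *m A.
Proof. by rewrite trmx_mul trmxK. Qed.

(** The square root in [singular_value] loses nothing: an eigenvalue of the Gram
    matrix is the squared norm of the image of a unit eigenvector. *)
Lemma singular_vector (R : realType) (n p : nat) (A : 'M[R]_(n, p)) (k : nat) :
  (k < p)%N ->
  exists x : 'cV[R]_p, sqn x = 1 /\ sqn (A *m x) = singular_value A k ^+ 2.
Proof.
move=> kp; have sz := size_eigenvalues_desc (gram_sym A).
have := unit_eigenvector (gram_sym A) (mem_nth 0 (_ : (k < size _)%N)).
rewrite sz => /(_ kp) [x [x1 Ax]]; exists x; split=> //.
set z := nth _ _ _ in Ax.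
have Axz : sqn (A *m x) = z.
  by rewrite sqn_gram -mulmxA Ax -scalemxAr mxE -sqnE x1 mulr1.
by rewrite /singular_value -/z sqr_sqrtr // -Axz sqn_ge0.
Qed.

(** The largest singular value is the operator norm: this is the upper Rayleigh
    bound for the Gram matrix. *)
Lemma sqn_mulmx_le (R : realType) (n p : nat) (A : 'M[R]_(n, p))
    (x : 'cV[R]_p) : sqn (A *m x) <= s_max A ^+ 2 * sqn x.
Proof.
have /andP[_] := rayleigh x (gram_sym A).
rewrite -sqn_gram => /le_trans; apply; apply: ler_wpM2r; first exact: sqn_ge0.
rewrite /s_max /singular_value /lambda_max nth0.
have [h0|h0] := leP 0 (head 0 (eigenvalues_desc (A^T *m A))).
  by rewrite sqr_sqrtr.
by apply: le_trans (ltW h0) (sqr_ge0 _).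
Qed.

Lemma condition_number_ge (R : realType) (n p m : nat) (A : 'M[R]_(n, p)) :
  ((m%:R)%:E <= condition_number A)%E ->
  m%:R ^+ 2 * s_min A ^+ 2 <= s_max A ^+ 2.
Proof.
rewrite /condition_number; have smin0 : 0 <= s_min A by exact: sqrtr_ge0.
have smax0 : 0 <= s_max A by exact: sqrtr_ge0.
case: eqP => [->|/eqP sN0]; first by rewrite expr0n mulr0 sqr_ge0.
have s0 : 0 < s_min A by rewrite lt_def sN0.
rewrite lee_fin ler_pdivlMr // -exprMn => H.
by rewrite lerXn2r ?nnegrE // mulr_ge0.
Qed.

(** Let u and v be unit vectors at which s_max and s_min are attained. A point of
    the net of mesh 1/2 near u has image at least s_max / 2, up to squares, because
    the error is absorbed by s_max itself. Hence if this net is not stretched,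
    s_max^2 <= 4 Q, and a point of the net of mesh 1/m near v has image at most of
    order s_min + s_max / m <= 2 s_max / m. *)
Lemma condition_number_net (R : realType) (n p m : nat) (A : 'M[R]_(n, p))
    (Q : R) :
  (0 < p)%N -> (p <= n)%N -> (1 < m)%N ->
  ((m%:R)%:E <= condition_number A)%E ->
  (exists2 k, sphere_net R (p := p) (m := 2) k
            & Q <= sqn (A *m grid_point R k)) \/
  (exists2 k, sphere_net R (p := p) (m := m) k
            & sqn (A *m grid_point R k) <= 16 * Q / m%:R ^+ 2).
Proof.
move=> p0 pn m1 /condition_number_ge kappa.
have m20 : 0 < m%:R ^+ 2 :> R by rewrite exprn_gt0 // ltr0n; lia.
have [u [u1 Au]] := singular_vector A p0.
have [k net_k uk] := sphere_net_approx (isT : (1 < 2)%N) u1.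
have [Qk|Qk] := leP Q (sqn (A *m grid_point R k)); first by left; exists k.
right.
have smaxQ : s_max A ^+ 2 <= 4 * Q.
  have := sqnD (A *m grid_point R k) (A *m (u - grid_point R k)).
  rewrite -mulmxDr addrC subrK Au -/(s_max A).
  have := sqn_mulmx_le A (u - grid_point R k).
  have := ler_wpM2l (sqr_ge0 (s_max A)) uk.
  by rewrite -natrX; lra.
have [v [v1 Av]] : exists x : 'cV[R]_p, sqn x = 1 /\ sqn (A *m x) = s_min A ^+ 2.
  by apply: singular_vector; rewrite (minn_idPr pn); lia.
have [l net_l vl] := sphere_net_approx m1 v1; exists l => //.
rewrite ler_pdivlMr // mulrC.
have := sqnD (A *m v) (A *m (grid_point R l - v)).
rewrite -mulmxDr addrC subrK Av => le1.
have := sqn_mulmx_le A (grid_point R l - v).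
rewrite -[sqn (grid_point R l - v)]sqnN opprB => le2.
have : m%:R ^+ 2 * sqn (v - grid_point R l) <= 1.
  by rewrite mulrC -ler_pdivlMr // mul1r.
move=> /(ler_wpM2l (sqr_ge0 (s_max A))) le3.
have := ler_wpM2l (ltW m20) le1; have := ler_wpM2l (ltW m20) le2; lra.
Qed.

(** * Tail of the condition number *)

Definition stretched d (T : measurableType d) (R : realType) (n p m : nat)
    (X : T -> 'M[R]_(n, p)) (Q : R) : set T :=
  [set w | exists2 k, sphere_net R (p := p) (m := m) k
                    & Q <= sqn (X w *m grid_point R k)].

Definition contracted d (T : measurableType d) (R : realType) (n p m : nat)
    (X : T -> 'M[R]_(n, p)) (Q : R) : set T :=
  [set w | exists2 k, sphere_net R (p := p) (m := m) k
                    & sqn (X w *m grid_point R k) <= Q].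

Lemma measurable_stretched d (T : measurableType d) (R : realType)
    (n p m : nat) (X : T -> 'M[R]_(n, p)) (Q : R) :
  random_matrix X -> measurable (stretched m X Q).
Proof.
move=> mX.
rewrite (_ : stretched m X Q = \bigcup_(k in sphere_net R (p := p) (m := m))
   [set w | Q <= sqn (X w *m grid_point R k)]).
  apply: fin_bigcup_measurable => // k _; rewrite -[X in measurable X]setTI.
  by apply: measurable_fun_le => //; exact: measurable_sqn_mulmx.
by [].
Qed.

Lemma measurable_contracted d (T : measurableType d) (R : realType)
    (n p m : nat) (X : T -> 'M[R]_(n, p)) (Q : R) :
  random_matrix X -> measurable (contracted m X Q).
Proof.
move=> mX.
rewrite (_ : contracted m X Q = \bigcup_(k in sphere_net R (p := p) (m := m))
   [set w | sqn (X w *m grid_point R k) <= Q]).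
  apply: fin_bigcup_measurable => // k _; rewrite -[X in measurable X]setTI.
  by apply: measurable_fun_le => //; exact: measurable_sqn_mulmx.
by [].
Qed.

Section bad_events.
Context d (T : measurableType d) (R : realType) (P : probability T R).
Context (n p : nat) (X : T -> 'M[R]_(n, p)) (S : 'M[R]_p) (c_m c_M : R).
Hypotheses (mX : random_matrix X) (gX : iid_gaussian_rows P X S).
Hypotheses (symS : S^T = S) (c_m0 : 0 < c_m).
Hypotheses (minS : c_m <= lambda_min S) (maxS : lambda_max S <= c_M).

Let variance_net m k : sphere_net R (p := p) (m := m) k ->
  c_m / 4 <= ((grid_point R k)^T *m S *m grid_point R k) ord0 ord0 <= c_M.
Proof.
move=> /andP[_ /andP[ge4 le1]].
have c_M0 : 0 <= c_M.
  have /andP[h1 h2] := rayleigh (grid_point R k) symS.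
  have := le_trans h1 h2; rewrite ler_pM2r; last first.
    by apply: lt_le_trans ge4; rewrite invr_gt0.
  move=> le_lambda; apply: le_trans maxS; apply: le_trans le_lambda.
  exact: le_trans (ltW c_m0) minS.
have /andP[h1 h2] := rayleigh (grid_point R k) symS.
apply/andP; split.
  apply: le_trans h1; apply: ler_pM => //; exact: ltW.
apply: le_trans h2 _; apply: (@le_trans _ _ (c_M * sqn (grid_point R k))).
  by apply: ler_wpM2r => //; exact: sqn_ge0.
by rewrite ler_piMr.
Qed.

Let union_over_net m (F : _ -> set T) (E : set T) (q : R) : (0 < m)%N ->
  0 <= q -> measurable E ->
  (forall k, sphere_net R (p := p) (m := m) k -> measurable (F k)) ->
  (forall w, E w -> exists2 k, sphere_net R (p := p) (m := m) k & F k w) ->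
  (forall k, sphere_net R (p := p) (m := m) k -> P (F k) <= q%:E)%E ->
  (P E <= ((4 * expR 1 * m%:R) ^+ p * q)%:E)%E.
Proof.
move=> m0 q0 mE mF cover Pq; apply: le_trans (union_bound mE mF cover Pq) _.
rewrite lee_fin sumr_const -[leLHS]mulr_natl; apply: ler_wpM2r => //.
exact: card_sphere_net.
Qed.

Lemma prob_stretched (L : nat) :
  (P (stretched 2 X (16 * c_M * L.+1%:R * n%:R))
     <= ((4 * expR 1 * 2) ^+ p * (4 / 2 ^+ L) ^+ n)%:E)%E.
Proof.
apply: (union_over_net (F := fun k =>
  [set w | 16 * c_M * L.+1%:R * n%:R <= sqn (X w *m grid_point R k)])) => //.
- exact: measurable_stretched.
- move=> k _; rewrite -[X in measurable X]setTI.
  by apply: measurable_fun_le => //; exact: measurable_sqn_mulmx.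
- move=> k /variance_net /andP[v1 v2]; apply: (gaussian_upper_tail mX gX L _ v2).
  by apply: lt_le_trans v1; rewrite divr_gt0.
Qed.

Lemma prob_contracted (m : nat) (e : R) : (0 < m)%N -> 0 < e ->
  (P (contracted m X (e ^+ 2 * n%:R))
     <= ((4 * expR 1 * m%:R) ^+ p * (16 * e / Num.sqrt c_m) ^+ n)%:E)%E.
Proof.
move=> m0 e0; have sc0 : 0 < Num.sqrt c_m by rewrite sqrtr_gt0.
apply: (union_over_net (F := fun k =>
  [set w | sqn (X w *m grid_point R k) <= e ^+ 2 * n%:R])) => //.
- by rewrite exprn_ge0 // divr_ge0 ?mulr_ge0 // ltW.
- exact: measurable_contracted.
- move=> k _; rewrite -[X in measurable X]setTI.
  by apply: measurable_fun_le => //; exact: measurable_sqn_mulmx.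
- move=> k /variance_net /andP[v1 _].
  have -> : 16 * e / Num.sqrt c_m = 8 * e / (Num.sqrt c_m / 2).
    by field; rewrite lt0r_neq0.
  apply: (gaussian_small_ball mX gX _ _ e0); first by rewrite divr_gt0.
  by rewrite exprMn sqr_sqrtr ?(ltW c_m0) // exprVn -natrX.
Qed.

End bad_events.

(** The sum of the two constants that come from stretched points and from
    contracted points; the factor [expR 1] comes from the size of the nets. *)
Definition decay_constant (R : realType) (c_m c_M : R) : R :=
  32 * expR 1 + 4 * expR 1 * (16 * (32 * (Num.sqrt c_M / Num.sqrt c_m))).

(** The tail is stated through a measurable set E containing the event, because
    the map w |-> [condition_number] (X w) is not known to be measurable. The
    scales are m = b^a and L = b: the net of mesh 1/m costs m^p, the small balls
    gain (sqrt b / m)^n, and m^(n - p) >= b^(2 n), which leaves b^-n up to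
    constants. *)
Lemma condition_number_tail d (T : measurableType d) (R : realType)
    (P : probability T R) (n p a b : nat) (X : T -> 'M[R]_(n, p))
    (S : 'M[R]_p) (c_m c_M : R) :
  random_matrix X -> iid_gaussian_rows P X S -> S^T = S -> 0 < c_m ->
  c_m <= c_M -> c_m <= lambda_min S -> lambda_max S <= c_M ->
  (0 < p)%N -> (p <= n)%N -> (2 * n <= a * (n - p))%N -> (1 < b)%N ->
  exists E : set T, [/\ measurable E,
    (forall w, ((b ^ a)%:R%:E <= condition_number (X w))%E -> E w) &
    (P E <= ((decay_constant c_m c_M / b%:R) ^+ n)%:E)%E].
Proof.
move=> mX gX symS cm0 cmM minS maxS p0 pn apn b1.
have cM0 : 0 < c_M by apply: lt_le_trans cmM.
have a0 : (0 < a)%N by case: a apn => //; lia.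
pose m := (b ^ a)%N; pose Q := 16 * c_M * b.+1%:R * n%:R.
have m1 : (1 < m)%N by rewrite -(exp1n a) ltn_exp2r.
have m0 : 0 < m%:R :> R by rewrite ltr0n ltnW.
have b0 : 0 < b%:R :> R by rewrite ltr0n ltnW.
pose e : R := 16 * Num.sqrt (c_M * b.+1%:R) / m%:R.
have cMb : 0 < c_M * b.+1%:R by rewrite mulr_gt0.
have e0 : 0 < e by rewrite divr_gt0 // mulr_gt0 // sqrtr_gt0.
have eQ : e ^+ 2 * n%:R = 16 * Q / m%:R ^+ 2.
  rewrite /e /Q !exprMn sqr_sqrtr ?(ltW cMb) // exprVn.
  by field; rewrite lt0r_neq0.
(* e is chosen so that e^2 n is the threshold 16 Q / m^2 for contracted points. *)
exists (stretched 2 X Q `|` contracted m X (e ^+ 2 * n%:R)).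
have mA := measurable_stretched 2 Q mX.
have mB := measurable_contracted m (e ^+ 2 * n%:R) mX.
split; first exact: measurableU.
  move=> w kappa; rewrite eQ.
  by have [] := condition_number_net Q p0 pn m1 kappa; [left|right].
apply: le_trans (measureU2 _ mA mB) _.
apply: le_trans (leeD (prob_stretched mX gX symS cm0 minS maxS b)
                 (prob_contracted mX gX symS cm0 minS maxS (ltnW m1) e0)) _.
rewrite -EFinD lee_fin.
have n0 : (0 < n)%N by apply: leq_trans pn.
have e1 : 1 <= expR 1 :> R by rewrite -expR0 ler_expR.
have sm0 : 0 < Num.sqrt c_m by rewrite sqrtr_gt0.
pose x : R := 32 * expR 1 / b%:R.
pose y := 4 * expR 1 * (16 * (32 * (Num.sqrt c_M / Num.sqrt c_m))) / b%:R.
have x0 : 0 <= x by rewrite !mulr_ge0 ?expR_ge0 ?invr_ge0 ?(ltW b0).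
have y0 : 0 <= y.
  by rewrite !mulr_ge0 ?expR_ge0 ?invr_ge0 ?sqrtr_ge0 ?(ltW b0).
have -> : decay_constant c_m c_M / b%:R = x + y.
  by rewrite /decay_constant mulrDl.
apply: (@le_trans _ _ (x ^+ n + y ^+ n)); last first.
  case: (n) n0 => // k _; elim: k => // k IH.
  rewrite exprS [y ^+ _]exprS [leRHS]exprS.
  have xk := exprn_ge0 k.+1 x0; have yk := exprn_ge0 k.+1 y0.
  have := ler_wpM2l (addr_ge0 x0 y0) IH.
  have := mulr_ge0 x0 yk; have := mulr_ge0 y0 xk; lra.
have powpn z : 1 <= z -> z ^+ p <= z ^+ n :> R by move=> z1; exact: ler_weXn2l.
apply: lerD.
  apply: (@le_trans _ _ ((4 * expR 1 * 2) ^+ n * (4 / 2 ^+ b) ^+ n)).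
    apply: ler_wpM2r; last by apply: powpn; lra.
    by rewrite exprn_ge0 // divr_ge0 // exprn_ge0.
  rewrite -exprMn lerXn2r ?nnegrE ?mulr_ge0 ?expR_ge0 ?invr_ge0 ?exprn_ge0 //.
  have -> : 4 * expR 1 * 2 * (4 / 2 ^+ b) = 32 * expR 1 * (2 ^+ b)^-1 :> R by ring.
  apply: ler_wpM2l; first by rewrite mulr_ge0 // expR_ge0.
  by rewrite lef_pV2 ?posrE ?exprn_gt0 // -natrX ler_nat ltnW // ltn_expl.
rewrite [(_ * m%:R) ^+ p]exprMn -[leLHS]mulrA.
have mpn : m%:R ^+ p * (m%:R^-1) ^+ n <= (b%:R ^+ 2)^-1 ^+ n :> R.
  rewrite -(subnKC pn) exprD mulrA -exprMn divff ?lt0r_neq0 // expr1n mul1r.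
  rewrite (subnKC pn) !exprVn lef_pV2 ?posrE ?exprn_gt0 //.
  rewrite natrX -!exprM ler_weXn2l //; by rewrite ler1n ltnW.
have -> : 16 * e / Num.sqrt c_m =
    16 * (16 * Num.sqrt (c_M * b.+1%:R)) / Num.sqrt c_m * m%:R^-1.
  by rewrite /e; ring.
rewrite [(_ * m%:R^-1) ^+ n]exprMn [m%:R ^+ p * _]mulrCA.
set f := 16 * _ / _.
have f0 : 0 <= f by rewrite !mulr_ge0 ?invr_ge0 ?sqrtr_ge0.
apply: (@le_trans _ _ ((4 * expR 1) ^+ n * (f ^+ n * (b%:R ^+ 2)^-1 ^+ n))).
  apply: ler_pM.
  - by rewrite exprn_ge0 // mulr_ge0 // expR_ge0.
  - by rewrite !mulr_ge0 ?exprn_ge0 ?invr_ge0 ?(ltW m0).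
  - by apply: powpn; lra.
  - by apply: ler_wpM2l mpn; rewrite exprn_ge0.
rewrite -!exprMn lerXn2r ?nnegrE ?mulr_ge0 ?expR_ge0 ?invr_ge0 ?sqr_ge0 //.
have sqb : Num.sqrt b.+1%:R <= 2 * b%:R :> R.
  rewrite -[leRHS]ger0_norm ?mulr_ge0 ?(ltW b0) // -sqrtr_sqr ler_wsqrtr //.
  have b1R : 1 <= b%:R :> R by rewrite ler1n ltnW.
  have b2 : b%:R <= b%:R ^+ 2 :> R by rewrite expr2 ler_peMl // ltW.
  by rewrite -natr1; lra.
rewrite /f sqrtrM ?(ltW cM0) //.
set r := Num.sqrt c_M; set s := Num.sqrt c_m.
have -> : y = 4 * expR 1 * (16 * (16 * (r * (2 * b%:R))) / s * (b%:R ^+ 2)^-1).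
  by rewrite /y -/r -/s; field; rewrite !lt0r_neq0.
apply: ler_wpM2l; first by rewrite mulr_ge0 // expR_ge0.
apply: ler_wpM2r; first by rewrite invr_ge0 sqr_ge0.
apply: ler_wpM2r; first by rewrite invr_ge0 ltW.
do 2!apply: ler_wpM2l => //.
by apply: ler_wpM2l => //; exact: sqrtr_ge0.
Qed.

(** * From tails to moments *)

Lemma le_truncnS (R : realType) (x : R) : x <= (Num.truncn x).+1%:R.
Proof.
have [x0|x0] := leP x 0; first exact: le_trans x0 (ler0n _ _).
by have /andP[_ /ltW] := truncn_itv (ltW x0).
Qed.

(** Nonnegative integrals are suprema over simple functions below the integrand,
    so they are monotone even when the smaller function is not measurable. *)
Lemma le_integralT_ge0 d (T : measurableType d) (R : realType)
    (mu : {measure set T -> \bar R}) (f g : T -> \bar R) :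
  (forall w, (0 <= f w)%E) -> (forall w, (f w <= g w)%E) ->
  (\int[mu]_w f w <= \int[mu]_w g w)%E.
Proof.
move=> f0 fg; have g0 w : (0 <= g w)%E by apply: le_trans (fg w).
rewrite !ge0_integralTE //; apply: ub_ereal_sup => _ [h hf <-].
by apply: ereal_sup_ubound; exists h => // w; apply: le_trans (hf w) (fg w).
Qed.

(** The real exponent is replaced by a natural number once and for all. *)
Lemma poweR_le_expn (R : realType) (x : \bar R) (t r : R) (N : nat) :
  0 <= r -> r <= N%:R -> (0 <= x)%E -> (x <= t%:E)%E -> 1 <= t ->
  (x `^ r <= (t ^+ N)%:E)%E.
Proof.
move=> r0 rN; case: x => [x| |]; [|by move=> _; rewrite leye_eq|by rewrite leeNy_eq].
rewrite poweR_EFin !lee_fin => x0 xt t1.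
have t0 : 0 <= t by apply: le_trans t1.
apply: (@le_trans _ _ (t `^ r)).
  by apply: ge0_ler_powR; rewrite ?nnegrE.
by rewrite -powR_mulrn // ler_powR.
Qed.

(** Layers: on the set where kappa lies between the thresholds number i and
    i + 1, counted in powers 2^a from 2^(j0 a), its N-th power is at most
    2^((j0 + i + 1) a N), while E i has probability at most 2^(- i (a N + 1)). The
    extra 1 in the exponent makes the series geometric. Points where kappa is
    infinite lie in every E i, and there the dominating series diverges. *)
Lemma integral_poweR_dyadic d (T : measurableType d) (R : realType)
    (P : probability T R) (kappa : T -> \bar R) (r : R) (N a j0 : nat)
    (E : nat -> set T) :
  0 <= r -> r <= N%:R -> (0 < N)%N -> (0 < a)%N ->
  (forall w, (0 <= kappa w)%E) ->
  (forall i, measurable (E i)) ->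
  (forall i w, (((2 ^ ((j0 + i) * a))%N%:R)%:E <= kappa w)%E -> E i w) ->
  (forall i, (P (E i) <= (((2 ^+ i)^-1) ^+ (a * N).+1)%:E)%E) ->
  (\int[P]_w (kappa w `^ r)
     <= (2 ^+ (j0 * a * N) * (1 + 2 * 2 ^+ (a * N)))%:E)%E.
Proof.
move=> r0 rN N0 a0 kappa0 mE kappaE PE.
pose t i : R := (2 ^ ((j0 + i) * a))%N%:R.
have t1 i : 1 <= t i by rewrite /t ler1n expn_gt0.
pose c i : R := t i.+1 ^+ N.
have c0 i : 0 <= c i by rewrite exprn_ge0.
have c1 i : 1 <= c i by rewrite exprn_ege1.
pose f i w : \bar R := ((c i)%:E * (\1_(E i) w)%:E)%E.
have f0 i w : (0 <= f i w)%E by rewrite mule_ge0 // lee_fin.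
pose D : R := 2 ^+ (j0 * a * N).
have D0 : 0 <= D by rewrite exprn_ge0.
have tD : t 0%N ^+ N = D by rewrite /t addn0 natrX -exprM.
pose g w : \bar R := (D%:E + \sum_(i <oo) f i w)%E.
have term_le i w : E i w -> ((c i)%:E <= \sum_(i <oo) f i w)%E.
  move=> Eiw; apply: le_trans (nneseries_lim_ge (m := 0) i.+1 _); last first.
    by move=> n _ _; exact: f0.
  rewrite big_nat_recr //= /f indicE mem_set // mule1 leeDr // sume_ge0 //.
  by move=> n _; exact: f0.
have kg w : (kappa w `^ r <= g w)%E.
  have S0 : (0 <= \sum_(i <oo) f i w)%E by apply: nneseries_ge0.
  have unbounded x : exists k, x <= t k :> R.
    exists (Num.truncn x).+1; rewrite /t.
    apply: le_trans (le_truncnS x) _.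
    rewrite ler_nat; apply: leq_trans (ltnW (ltn_expl _ (isT : (1 < 2)%N))) _.
    by rewrite leq_exp2l //; nia.
  case: (eqVneq (kappa w) +oo%E) => [kw|kfin].
    suff -> : g w = +oo%E by rewrite leey.
    apply: eq_infty => x; have [k xk] := unbounded x.
    apply: (@le_trans _ _ (c k)%:E).
      rewrite lee_fin; apply: le_trans xk _; apply: (@le_trans _ _ (t k.+1)).
        by rewrite ler_nat leq_exp2l //; nia.
      by rewrite -[leLHS]expr1 ler_weXn2l.
    rewrite /g; apply: le_trans (term_le k w _) _; last by rewrite leeDr ?lee_fin.
    by apply: kappaE; rewrite kw leey.
  have [x kx] : exists x, kappa w = x%:E.
    by move: (kappa0 w) kfin; case: (kappa w) => // x; exists x.
  have [k0 xk0] := unbounded x.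
  have ex : exists k, x <= t k by exists k0.
  (* The least threshold above x; the one before it, if any, is below x. *)
  case: (ex_minnP ex) => -[|k] xk kmin.
    apply: (@le_trans _ _ D%:E); last by rewrite /g leeDl.
    by rewrite -tD; apply: poweR_le_expn => //; rewrite kx lee_fin.
  apply: (@le_trans _ _ (c k)%:E).
    by apply: poweR_le_expn => //; rewrite kx lee_fin.
  rewrite /g; apply: le_trans (term_le k w _) _; last by rewrite leeDr ?lee_fin.
  apply: kappaE; rewrite kx lee_fin leNgt; apply/negP => /ltW /kmin.
  by rewrite ltnn.
apply: le_trans (le_integralT_ge0 _ _ kg) _; first by move=> w; exact: poweR_ge0.
have mf i : measurable_fun setT (f i).
  by apply: measurable_funeM; apply/measurable_EFinP; exact: measurable_indic.
rewrite /g ge0_integralD //; last 2 first.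
- by move=> w _; apply: nneseries_ge0 => i _ _; exact: f0.
- by apply: ge0_emeasurable_sum.
rewrite integral_cst // [X in (_ * X)%E](@probability_setT _ _ _ P) mule1 mulrDr mulr1 EFinD.
apply: leeD; first by [].
rewrite integral_nneseries //.
apply: (@le_trans _ _ (\sum_(i <oo) (D * 2 ^+ (a * N) * (2 ^+ i)^-1)%:E)%E).
  apply: lee_nneseries => i _.
    by move=> _; apply: integral_ge0.
  rewrite /f ge0_integralZl ?lee_fin //; last first.
    by apply/measurable_EFinP; exact: measurable_indic.
  rewrite integral_indic // setIT.
  apply: (@le_trans _ _ ((c i)%:E * (((2 ^+ i)^-1) ^+ (a * N).+1)%:E)%E).
    by apply: lee_wpmul2l; [rewrite lee_fin|exact: PE].
  rewrite -EFinM lee_fin le_eqVlt; apply/orP; left; apply/eqP.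
  rewrite /c /t natrX -exprM /D.
  have -> : ((j0 + i.+1) * a * N = j0 * a * N + a * N + i * (a * N))%N by lia.
  rewrite !exprD -!mulrA; congr (_ * (_ * _)).
  by rewrite exprVn exprM exprS invfM mulrCA divff ?mulr1 // !expf_neq0.
apply: lime_le.
  by apply: is_cvg_nneseries => i _ _; rewrite lee_fin !mulr_ge0 // ?invr_ge0 ?exprn_ge0.
apply: nearW => n; rewrite sumEFin lee_fin -mulr_sumr -mulrA -/D.
apply: ler_wpM2l => //; rewrite [2 * _]mulrC; apply: ler_wpM2l.
  exact: exprn_ge0.
by rewrite big_mkord; exact: sum_half_pow.
Qed.

(** * Boundedness of the moments *)

Lemma condition_number_ge0 (R : realType) (n p : nat) (A : 'M[R]_(n, p)) :
  (0 <= condition_number A)%E.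
Proof.
rewrite /condition_number; case: ifP => // _.
by rewrite lee_fin divr_ge0 // sqrtr_ge0.
Qed.

Theorem theorem2p1 (R : realType) (r gamma c_m c_M : R) :
  0 <= r -> 0 <= gamma < 1 -> 0 < c_m -> c_m <= c_M ->
  exists K1 : R, 0 < K1 /\
    forall (p : nat -> nat)
           (Sigma : forall n : nat, 'M[R]_(p n))
           (d : nat -> measure_display)
           (T : forall n : nat, measurableType (d n))
           (P : forall n : nat, probability (T n) R)
           (X : forall n : nat, T n -> 'M[R]_(n, p n)),
      (forall n : nat, (0 < n)%N -> (0 < p n)%N) ->
      (p n)%:R / n%:R @[n --> \oo] --> gamma ->
      (forall n : nat, (0 < n)%N -> (Sigma n)^T = Sigma n) ->
      (c_m%:E <= ereal_inf [set (lambda_min (Sigma n))%:E | n in [set n | (0 < n)%N]])%E ->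
      (ereal_inf [set (lambda_min (Sigma n))%:E | n in [set n | (0 < n)%N]]
        <= ereal_sup [set (lambda_max (Sigma n))%:E | n in [set n | (0 < n)%N]])%E ->
      (ereal_sup [set (lambda_max (Sigma n))%:E | n in [set n | (0 < n)%N]] <= c_M%:E)%E ->
      (forall n : nat, (0 < n)%N -> random_matrix (X n)) ->
      (forall n : nat, (0 < n)%N -> iid_gaussian_rows (P n) (X n) (Sigma n)) ->
      \forall n \near \oo,
        (\int[P n]_w (condition_number (X n w) `^ r) <= K1%:E)%E.
Proof.
move=> r0 /andP[g0 g1] cm0 cmM.
(* Any g strictly between gamma and 1 would do; a and j0 make a (1 - g) >= 2 and
   2^j0 at least the decay constant. *)
pose g := (1 + gamma) / 2.
have gg : gamma < g by rewrite /g; lra.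
have g1' : 0 < 1 - g by rewrite /g; lra.
pose a := (Num.truncn (2 / (1 - g))).+1.
have ag : 2 <= a%:R * (1 - g) by rewrite -ler_pdivrMr // le_truncnS.
pose N := (Num.truncn r).+1.
have rN : r <= N%:R by exact: le_truncnS.
pose C := decay_constant c_m c_M.
pose j0 := (Num.truncn C).+1.
have Cj : C <= 2 ^+ j0.
  apply: le_trans (le_truncnS C) _; rewrite -natrX ler_nat.
  by apply: ltnW; exact: ltn_expl.
have C0 : 0 <= C.
  by rewrite addr_ge0 ?divr_ge0 ?mulr_ge0 ?expR_ge0 ?divr_ge0 ?sqrtr_ge0.
exists (2 ^+ (j0 * a * N) * (1 + 2 * 2 ^+ (a * N))); split.
  by rewrite mulr_gt0 ?exprn_gt0 // addr_gt0 // mulr_gt0 ?exprn_gt0.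
move=> p Sigma d T P X p0 pn_gamma symS minS _ maxS mX gX.
have pn_g : \forall n \near \oo, (p n)%:R / n%:R < g.
  exact: (cvgr_lt gamma).
near=> n.
have n0 : (0 < n)%N by near: n; exact: nbhs_infty_gt.
have nN : ((a * N).+1 <= n)%N by near: n; exact: nbhs_infty_ge.
have pg : (p n)%:R / n%:R < g by near: n.
have nR : 0 < n%:R :> R by rewrite ltr0n.
have png : (p n)%:R <= g * n%:R by rewrite ltW // -ltr_pdivrMr.
have gn : g * n%:R <= n%:R by rewrite ler_piMl // ltW // -subr_gt0.
have pn : (p n <= n)%N by rewrite -(ler_nat R); exact: le_trans gn.
have apn : (2 * n <= a * (n - p n))%N.
  rewrite -(ler_nat R) !natrM natrB //.
  apply: (@le_trans _ _ (a%:R * (1 - g) * n%:R)); first exact: ler_wpM2r.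
  by rewrite -mulrA; apply: ler_wpM2l => //; lra.
have minSn : c_m <= lambda_min (Sigma n).
  rewrite -lee_fin; apply: le_trans minS _; apply: ereal_inf_lbound.
  by exists n.
have maxSn : lambda_max (Sigma n) <= c_M.
  rewrite -lee_fin; apply: le_trans maxS; apply: ereal_sup_ubound.
  by exists n.
have /choice[E HE] : forall i, exists E : set (T n), [/\ measurable E,
    (forall w, (((2 ^ (j0 + i)) ^ a)%N%:R%:E <= condition_number (X n w))%E ->
       E w) &
    (P n E <= ((C / (2 ^ (j0 + i))%N%:R) ^+ n)%:E)%E].
  move=> i; apply: (condition_number_tail (mX n n0) (gX n n0) (symS n n0) cm0 cmM
    minSn maxSn (p0 n n0) pn apn).
  by rewrite -[X in (X < _)%N](exp1n (j0 + i)) ltn_exp2r.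
apply: (integral_poweR_dyadic (E := E)) => //.
- by move=> w; exact: condition_number_ge0.
- by move=> i; have [] := HE i.
- by move=> i w; have [_ + _] := HE i; rewrite -expnM; apply.
move=> i; have [_ _ le_P] := HE i; apply: le_trans le_P _; rewrite lee_fin.
have x0 : 0 <= C / (2 ^ (j0 + i))%N%:R by rewrite divr_ge0.
have xi : C / (2 ^ (j0 + i))%N%:R <= (2 ^+ i)^-1.
  rewrite natrX exprD invfM mulrA ler_piMl ?invr_ge0 ?exprn_ge0 //.
  by rewrite ler_pdivrMr ?exprn_gt0 // mul1r.
apply: (@le_trans _ _ ((2 ^+ i)^-1 ^+ n)).
  by rewrite lerXn2r ?nnegrE // invr_ge0 exprn_ge0.
apply: ler_wiXn2l => //; rewrite ?invr_ge0 ?exprn_ge0 //.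
by rewrite invf_le1 ?exprn_gt0 // exprn_ege1 // ler1n.
Unshelve. all: by end_near. Qed.
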